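(* Let $P$ be a Reuleaux polygon of width $1$ in the plane, with skeleton polygon $\mathcal S(P)$ and tangent circumscribed polygon $\mathcal C(P)$. Then for every planar convex body $K$ with $\mathcal S(P)\subset K\subset \mathcal C(P)$, \[ A(K,-K)=A(P,-P)=A(\mathcal S(P),-\mathcal S(P))=A(\mathcal C(P),-\mathcal C(P)). \]
   Context: For planar convex bodies (nonempty compact convex subsets of $\mathbb R^2$), $A(K)$ denotes the area, $-K=\{-x: x\in K\}$, $K_1+K_2=\{a+b: a\in K_1, b\in K_2\}$ is the Minkowski sum, and the mixed area $A(K_1,K_2)$ is defined by $A(K_1+K_2)=A(K_1)+2A(K_1,K_2)+A(K_2)$. A planar convex body has constant width $1$ if the distance between any two distinct parallel supporting lines is $1$. A Reuleaux polygon (of width $1$) is a planar convex body $P$ of constant width $1$ whose boundary is a union of finitely many (an odd number $n=2k+1\ge 3$) arcs of circles of radius $1$, each arc being centered at a vertex of $P$; the vertices of $P$ are the common endpoints of consecutive arcs. The skeleton polygon $\mathcal S(P)$ is the convex hull of the vertices of $P$ (equivalently, $P$ with all its circular caps removed). The tangent circumscribed polygon $\mathcal C(P)$ is the polygon containing $P$ obtained by drawing, for each boundary arc of $P$, the tangent lines to that arc at its two endpoints; that is, $\mathcal C(P)$ is the intersection of all closed half-planes that contain $P$ and are bounded by one of these tangent lines. *)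

(* Defs.v *)
From mathcomp Require Import all_boot all_order all_algebra.
From mathcomp Require Import all_classical all_reals all_analysis.

Set Implicit Arguments.
Unset Strict Implicit.
Unset Printing Implicit Defensive.

Import Order.TTheory GRing.Theory Num.Theory.
Import numFieldNormedType.Exports.

Local Open Scope classical_set_scope.
Local Open Scope ring_scope.

(* [R^o] makes the product an [lmodType R]. Its library norm is the max-norm,
   which generates the usual topology; the Euclidean norm is [enorm]. *)
Notation plane R := (R^o * R^o)%type.

Section planar_geometry.
Variable R : realType.
Implicit Types (x y u v : plane R) (K L : set (plane R)).

Definition dot x y : R := x.1 * y.1 + x.2 * y.2.

Definition enorm x : R := Num.sqrt (dot x x).

Definition convex_body K : Prop := [/\ K !=set0, compact K & convex_set K].

Definition convex_hull (A : set (plane R)) : set (plane R) :=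
  smallest (@convex_set R (plane R)) A.

Definition boundary K : set (plane R) := closure K `\` interior K.

Definition area K : R :=
  fine ((@lebesgue_measure R \x @lebesgue_measure R)%E K).

Definition minkowski_sum K L : set (plane R) := [set x + y | x in K & y in L].

Definition reflection K : set (plane R) := [set - x | x in K].

Definition mixed_area K L : R :=
  (area (minkowski_sum K L) - area K - area L) / 2.

(* The next two denote a line, resp. a closed half-plane, only if [u != 0]. *)
Definition line u (c : R) : set (plane R) := [set x | dot u x = c].

Definition half_plane u (c : R) : set (plane R) := [set x | dot u x <= c].

Definition supports u (c : R) K : Prop :=
  K `&` line u c !=set0 /\
  (K `<=` half_plane u c \/ K `<=` half_plane (- u) (- c)).

Definition set_dist K L : R := inf [set enorm (x - y) | x in K & y in L].

Definition constant_width (w : R) K : Prop :=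
  forall u (c d : R), u != 0 -> c != d ->
    supports u c K -> supports u d K -> set_dist (line u c) (line u d) = w.

(* The arc of radius 1 about [arc_center] swept counterclockwise from the polar
   angle [arc_start] to the polar angle [arc_stop]. *)
Record unit_arc := UnitArc { arc_center : plane R; arc_start : R; arc_stop : R }.

Implicit Type g : unit_arc.

Definition arc_point g (t : R) : plane R := arc_center g + (cos t, sin t).

Definition arc_source g : plane R := arc_point g (arc_start g).

Definition arc_target g : plane R := arc_point g (arc_stop g).

Definition closed_arc g : set (plane R) :=
  [set arc_point g t | t in `[arc_start g, arc_stop g]].

Definition open_arc g : set (plane R) :=
  [set arc_point g t | t in `]arc_start g, arc_stop g[].

Definition vertices n (g : 'I_n -> unit_arc) : set (plane R) :=
  [set arc_source (g i) | i in [set: 'I_n]].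

(* [g] lists the boundary arcs in counterclockwise cyclic order; [ordS] is the
   cyclic successor, so [vertices g] is the set of common endpoints of
   consecutive arcs. *)
Record reuleaux_polygon (P : set (plane R)) n (g : 'I_n -> unit_arc) : Prop := {
  reuleaux_body : convex_body P;
  reuleaux_width : constant_width 1 P;
  reuleaux_odd : odd n;
  reuleaux_ge3 : (3 <= n)%N;
  reuleaux_arc : forall i, arc_start (g i) < arc_stop (g i) < arc_start (g i) + 2 * pi;
  reuleaux_consecutive : forall i, arc_target (g i) = arc_source (g (ordS i));
  reuleaux_disjoint : forall i j, i != j ->
    open_arc (g i) `&` open_arc (g j) = set0;
  reuleaux_boundary : boundary P = \bigcup_i closed_arc (g i);
  reuleaux_center : forall i, vertices g (arc_center (g i))
}.

Definition skeleton_polygon n (g : 'I_n -> unit_arc) : set (plane R) :=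
  convex_hull (vertices g).

Definition tangent_line g (p : plane R) : set (plane R) :=
  line (p - arc_center g) (dot (p - arc_center g) p).

Definition tangent_polygon (P : set (plane R)) n (g : 'I_n -> unit_arc) :
    set (plane R) :=
  [set x | forall u c, u != 0 -> P `<=` half_plane u c ->
     (exists i, line u c = tangent_line (g i) (arc_source (g i)) \/
                line u c = tangent_line (g i) (arc_target (g i))) ->
     half_plane u c x].

End planar_geometry.

(* Main.v *)
Require Import Defs.
From mathcomp Require Import all_boot all_order all_algebra.
From mathcomp Require Import all_classical all_reals all_analysis.
From mathcomp Require Import measurable_realfun ring lra.

Set Implicit Arguments.
Unset Strict Implicit.
Unset Printing Implicit Defensive.

Import Order.TTheory GRing.Theory Num.Theory.
Import numFieldNormedType.Exports.

Local Open Scope classical_set_scope.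
Local Open Scope ring_scope.

(** For an arc [i] of [P] let [c] be its centre, let [p] and [q] be the unit
    vectors from [c] to its endpoints, and let [H i] be the half-plane of
    the vectors beyond the chord, [dot w (p + q) > 1 + dot p q]. A body [K]
    between the skeleton [S] and the tangent polygon [C] is free only in the
    caps [K `&` (c + H i)]: these are disjoint for different arcs
    ([cap_disjoint]), and [C] without them is contained in [S]
    ([tangent_cover]). So the area of [K] is a constant plus the sum of the
    areas of its caps.

    The difference body [K - K] has the same structure. It lies between
    [S - S] and [C - C]; the half-planes [H i] and [- H i] are disjoint in
    [C - C] ([difference_cap_inj], [difference_cap_opp]), and [C - C]
    without them is contained in [S - S] ([difference_cover]). The decisive
    point is that the part of [K - K] in [H i] is the cap of [K] moved by
    [- c] and nothing more ([cap_difference]): the tangents of [P] at the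
    vertex [c] confine [K - c] to vectors with nonnegative inner products
    with [p] and [q], so that subtracting such a vector from a vector of
    [K - c] pulls it back towards the chord, inside a triangle that [K - c]
    contains. Hence the area of [K - K] is a constant plus twice the sum of
    the areas of the caps of [K]. The mixed area of [K] and [- K] is half of
    the area of [K - K] minus the area of [K], and the caps cancel.

    The shape of [P] enters through three facts. Constant width bounds the
    diameter by 1 ([reuleaux_diameter]). A normal of [P] at an interior
    point of an arc is radial ([open_arc_normal]). A normal of [P] at a
    vertex is a nonnegative combination of the radii of the two arcs that
    meet there, so that it supports [C] at that vertex too
    ([vertex_normal]). Applied at the centre of an arc, which is a vertex,
    the last fact gives the tangents of [C] there without tracing which arcs
    meet at that centre. The two covering statements follow by separating a
    point from [S] or [S - S] and looking at the points of [P] that are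
    extreme in the separating direction. *)

(** * Vectors of the plane *)

Section plane_vectors.
Variable R : realType.
Implicit Types (x y z p q u v w e : plane R) (r s t : R).

Lemma dotC x y : dot x y = dot y x.
Proof. by rewrite /dot mulrC (mulrC x.2). Qed.

Lemma dotDl x y z : dot (x + y) z = dot x z + dot y z.
Proof. rewrite /dot /=; ring. Qed.

Lemma dotZl r x y : dot (r *: x) y = r * dot x y.
Proof. by rewrite /dot /= mulrDr !mulrA. Qed.

Lemma dotNl x y : dot (- x) y = - dot x y.
Proof. by rewrite /dot /= !mulNr opprD. Qed.

Lemma dotDr x y z : dot x (y + z) = dot x y + dot x z.
Proof. by rewrite dotC dotDl !(dotC x). Qed.

Lemma dotZr r x y : dot x (r *: y) = r * dot x y.
Proof. by rewrite dotC dotZl (dotC x). Qed.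

Lemma dotNr x y : dot x (- y) = - dot x y.
Proof. by rewrite dotC dotNl (dotC x). Qed.

Definition dotE := (dotDl, dotDr, dotZl, dotZr, dotNl, dotNr).

Lemma dot_ge0 x : 0 <= dot x x.
Proof. by rewrite /dot addr_ge0// -expr2 sqr_ge0. Qed.

Lemma dot_eq0 x : dot x x = 0 -> x = 0.
Proof.
case: x => x1 x2; rewrite /dot /= -!expr2 => /eqP.
by rewrite paddr_eq0 ?sqr_ge0// !sqrf_eq0 => /andP[/eqP-> /eqP->].
Qed.

Lemma dot_gt0 x : x != 0 -> 0 < dot x x.
Proof.
move=> x0; rewrite lt_def dot_ge0 andbT; apply: contra_neq x0; exact: dot_eq0.
Qed.

Definition cross x y : R := x.1 * y.2 - x.2 * y.1.

Lemma lagrange_identity x y :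
  dot x y ^+ 2 + cross x y ^+ 2 = dot x x * dot y y.
Proof. rewrite /dot /cross; ring. Qed.

Lemma dot_le1 x y : dot x x <= 1 -> dot y y <= 1 -> dot x y <= 1.
Proof.
move=> x1 y1; have := dot_ge0 (x - y); rewrite !dotE (dotC y x); lra.
Qed.

Lemma dot_eq1 x y : dot x x <= 1 -> dot y y <= 1 -> dot x y = 1 -> x = y.
Proof.
move=> x1 y1 xy; apply/eqP; rewrite -subr_eq0; apply/eqP/dot_eq0/le_anti.
rewrite dot_ge0 andbT !dotE (dotC y x); lra.
Qed.

(** A vector is determined by its inner products with two independent vectors,
    so vector identities below are checked against the endpoints of an arc. *)
Lemma dot_frame_inj p q x y : cross p q != 0 ->
  dot x p = dot y p -> dot x q = dot y q -> x = y.
Proof.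
case: p q x y => p1 p2 [q1 q2] [x1 x2] [y1 y2]; rewrite /dot /cross /= => pq xp xq.
by congr (_, _); apply: (mulIf pq);
  [have : q2 * (x1 * p1 + x2 * p2) - p2 * (x1 * q1 + x2 * q2) =
      q2 * (y1 * p1 + y2 * p2) - p2 * (y1 * q1 + y2 * q2) by rewrite xp xq
  |have : p1 * (x1 * q1 + x2 * q2) - q1 * (x1 * p1 + x2 * p2) =
      p1 * (y1 * q1 + y2 * q2) - q1 * (y1 * p1 + y2 * p2) by rewrite xp xq];
  lra.
Qed.

Lemma cross_frame p q x : cross p q != 0 ->
  x = (cross x q / cross p q) *: p + (cross p x / cross p q) *: q.
Proof.
case: p q x => p1 p2 [q1 q2] [x1 x2]; rewrite /cross /= => pq.
congr (_, _) => /=; rewrite /GRing.scale /=; field; exact: pq.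
Qed.

Lemma parallel_unit p n : dot p p = 1 -> cross p n = 0 -> n = dot n p *: p.
Proof.
case: p n => p1 p2 [n1 n2]; rewrite /dot /cross /= => pp pn.
congr (_, _) => /=; rewrite /GRing.scale /=.
  by rewrite -[LHS]mulr1 -pp; have := congr1 ( *%R p2) pn; lra.
by rewrite -[LHS]mulr1 -pp; have := congr1 ( *%R p1) pn; lra.
Qed.

Lemma affine_shift (c : plane R) x u v s t r : s + t + r = 1 ->
  c + (s *: (x - c) + t *: u + r *: v) = s *: x + t *: (c + u) + r *: (c + v).
Proof.
move=> str; have -> : s = 1 - t - r by rewrite -str; ring.
case: c x u v => c1 c2 [x1 x2] [u1 u2] [v1 v2].
congr (_, _) => /=; rewrite /GRing.scale /=; ring.
Qed.

Definition direction t : plane R := (cos t, sin t).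

Lemma direction_half_turn t : direction (t + pi) = - direction t :> plane R.
Proof. by rewrite /direction sinDpi cosDpi. Qed.

Lemma direction_rotate s t :
  direction (s + t) = cos t *: direction s + sin t *: (- sin s, cos s) :> plane R.
Proof.
rewrite /direction cosD sinD; congr (_, _) => /=; rewrite /GRing.scale /=; ring.
Qed.

Lemma dot_direction s t : dot (direction s) (direction t) = cos (t - s).
Proof. rewrite /dot /= cosB; ring. Qed.

Lemma dot_directionv t : dot (direction t) (direction t) = 1.
Proof. by rewrite dot_direction subrr cos0. Qed.

Lemma direction_neq0 t : direction t != 0 :> plane R.
Proof.
apply/eqP => t0; have := dot_directionv t; rewrite t0 /dot /= !mul0r addr0.
by move/eqP; rewrite eq_sym oner_eq0.
Qed.

Lemma cross_direction s t : cross (direction s) (direction t) = sin (t - s).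
Proof. rewrite /cross /= sinB; ring. Qed.

(** The angle from [direction a] to [x] is the arccosine of the normalised
    inner product: it lies in ]0, pi[ because [x] is on the left of
    [direction a], and it is less than [b - a] because [x] is on the right of
    [direction b]. *)
Lemma open_sectorP a b x : 0 < b - a < pi ->
    0 < cross (direction a) x -> 0 < cross x (direction b) ->
  exists r t, [/\ 0 < r, a < t < b & x = r *: direction t].
Proof.
move=> /andP[ab0 abpi] ax xb.
have sab : 0 < sin (b - a) by apply: sin_gt0_pi; rewrite ab0.
have x0 : x != 0 by apply: contraTneq ax => ->; rewrite /cross /= !mulr0 subrr ltxx.
have xx := dot_gt0 x0.
pose r := Num.sqrt (dot x x).
have r0 : 0 < r by rewrite sqrtr_gt0.
have rr : r * r = dot x x by rewrite -expr2 sqr_sqrtr ?dot_ge0.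
have := lagrange_identity (direction a) x; rewrite dot_directionv mul1r -rr => lag.
pose c := dot (direction a) x / r; pose d := cross (direction a) x / r.
have d0 : 0 < d by rewrite divr_gt0.
have cd : c ^+ 2 + d ^+ 2 = 1.
  by rewrite !expr_div_n -mulrDl lag -expr2 divff// expf_neq0// gt_eqF.
have c1 : -1 <= c <= 1 by nra.
pose th := acos c.
have cth : cos th = c by rewrite acosK// in_itv.
have sth : sin th = d.
  rewrite sin_acos//; have -> : 1 - c ^+ 2 = d ^+ 2 by lra.
  by rewrite sqrtr_sqr gtr0_norm.
have xE : x = r *: direction (a + th).
  have E1 : dot (direction a) x = r * c by rewrite /c mulrC divfK// gt_eqF.
  have E2 : cross (direction a) x = r * d by rewrite /d mulrC divfK// gt_eqF.
  have csa := cos2Dsin2 a.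
  case: (x) E1 E2 => x1 x2; rewrite /dot /cross /= => E1 E2.
  congr (_, _); rewrite /GRing.scale /= ?cosD ?sinD cth sth.
    rewrite mulrBr [X in X - _]mulrCA [X in _ - X]mulrCA -E1 -E2.
    by rewrite -[LHS]mul1r -csa; ring.
  rewrite mulrDr [X in X + _]mulrCA [X in _ + X]mulrCA -E1 -E2.
  by rewrite -[LHS]mul1r -csa; ring.
have th0 : 0 < th < pi.
  have := acos_ge0 c1; have := acos_lepi c1; rewrite -/th => thpi th0.
  apply/andP; split; rewrite lt_neqAle ?thpi ?th0 andbT; apply/eqP => h.
    by move: d0; rewrite -sth -h sin0 ltxx.
  by move: d0; rewrite -sth h sinpi ltxx.
exists r, (a + th); split => //; apply/andP; split; first lra.
have sb : 0 < sin (b - (a + th)).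
  move: xb; rewrite xE /cross /= /GRing.scale /= -!mulrA -mulrBr pmulr_rgt0// => H.
  by rewrite -cross_direction.
rewrite ltNge; apply/negP => bt.
have : 0 <= sin (a + th - b) by apply: sin_ge0_pi; apply/andP; split; lra.
have -> : a + th - b = - (b - (a + th)) by ring.
by rewrite sinN; lra.
Qed.

(** Cramer's rule in the frame of [direction a] and [direction b]. *)
Lemma sector_comb a b t : 0 < b - a < pi -> a < t < b ->
  exists s r, [/\ 0 < s, 0 < r & direction t = s *: direction a + r *: direction b].
Proof.
move=> ab /andP[at_ tb].
have sab : 0 < sin (b - a) by apply: sin_gt0_pi.
exists (sin (b - t) / sin (b - a)), (sin (t - a) / sin (b - a)); split.
- by rewrite divr_gt0// sin_gt0_pi//; lra.
- by rewrite divr_gt0// sin_gt0_pi//; lra.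
rewrite -!cross_direction -cross_frame// cross_direction; exact: lt0r_neq0.
Qed.

Lemma polar_inj r r' t t' : 0 < r -> 0 < r' ->
  r *: direction t = r' *: direction t' :> plane R -> direction t = direction t' :> plane R.
Proof.
move=> r0 r0' E.
have : r ^+ 2 = r' ^+ 2.
  have := congr1 (fun x => dot x x) E; rewrite /= !dotE !dot_directionv !mulr1.
  by rewrite !expr2.
move/eqP; rewrite eqrXn2// ?ltW// => /eqP rr.
by move: E; rewrite -rr => /(scalerI (lt0r_neq0 r0)).
Qed.

End plane_vectors.

(** * Chords of the unit circle *)

Section caps.
Variable R : realType.
Implicit Types (x y z p q u v w e : plane R) (r s t : R).

(** When [p] and [q] are unit vectors the equation
    [dot w (p + q) = 1 + dot p q] is that of the line through [p] and [q], so
    this is the open half-plane cut off by that line on the side away from the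
    origin. *)
Definition beyond_chord p q : set (plane R) := [set w | 1 + dot p q < dot w (p + q)].

Variables (a b : R).
Hypothesis ab : 0 < b - a < pi.
Let p : plane R := direction a.
Let q : plane R := direction b.
Let c := dot p q.

Let pp : dot p p = 1. Proof. exact: dot_directionv. Qed.
Let qq : dot q q = 1. Proof. exact: dot_directionv. Qed.
Let pq0 : 0 < cross p q.
Proof. by rewrite cross_direction sin_gt0_pi. Qed.
Let c2 : c ^+ 2 < 1.
Proof.
have := lagrange_identity p q; rewrite pp qq mulr1 -/c => <-.
by rewrite ltrDl exprn_gt0.
Qed.
Let cN1 : -1 < c. Proof. have := c2; nra. Qed.
Let c1 : c < 1. Proof. have := c2; nra. Qed.

(** The bounds [dot x p <= 1] and [dot x q <= 1] are the tangents of the unit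
    circle at [p] and [q]. Together with the chord they enclose an isosceles
    triangle, which lies in the open sector spanned by [p] and [q]. *)
Lemma cap_polar x : dot x p <= 1 -> dot x q <= 1 -> beyond_chord p q x ->
  exists r t, [/\ 0 < r, a < t < b & x = r *: direction t].
Proof.
rewrite /beyond_chord /= dotDr -/c => xp xq xpq; apply: open_sectorP => //.
  rewrite -(pmulr_rgt0 _ pq0).
  have -> : cross p q * cross p x = dot p p * dot x q - dot x p * c.
    by rewrite /c /cross /dot; ring.
  rewrite pp; have := cN1; nra.
rewrite -(pmulr_rgt0 _ pq0).
have -> : cross p q * cross x q = dot q q * dot x p - dot x q * c.
  by rewrite /c /cross /dot; ring.
rewrite qq; have := cN1; nra.
Qed.

Lemma cap_comb r t : 0 < r -> a < t < b -> beyond_chord p q (r *: direction t) ->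
  exists i j, [/\ 0 < i, 0 < j, 1 < i + j & r *: direction t = i *: p + j *: q].
Proof.
move=> r0 atb; have [i [j [i0 j0 tE]]] := sector_comb ab atb.
rewrite /beyond_chord /= tE => H; exists (r * i), (r * j).
have ri0 : 0 < r * i by rewrite mulr_gt0.
have rj0 : 0 < r * j by rewrite mulr_gt0.
split => //; last by rewrite scalerDr !scalerA.
move: H; rewrite -/p -/q !dotE (dotC q p) pp qq -/c => H.
by have := cN1; nra.
Qed.

(** Let [A] be the apex where the tangents at [p] and [q] meet. The conditions
    comparing [w] with [x] say that [w] lies in the translate to [x] of the
    cone at [A] that contains [p] and [q]. Above the chord, this translate is
    a triangle similar to [A p q] whose base lies in the segment [p q], so it
    is contained in the triangle [x p q]. *)
Lemma cap_triangle x w : dot w p <= dot x p -> dot w q <= dot x q ->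
    dot x p <= 1 -> dot x q <= 1 -> beyond_chord p q w ->
  exists s t r, [/\ 0 <= s, 0 <= t, 0 <= r, s + t + r = 1 &
    w = s *: x + t *: p + r *: q].
Proof.
rewrite /beyond_chord /= dotDr -/c => wp wq xp xq wc.
pose f := dot x p + dot x q - (1 + c).
pose s := (dot w p + dot w q - (1 + c)) / f.
have f0 : 0 < f by rewrite /f; lra.
have sf : s * f = dot w p + dot w q - (1 + c) by rewrite /s divfK// gt_eqF.
have s0 : 0 <= s by rewrite divr_ge0// /f; lra.
have s1 : s <= 1 by rewrite ler_pdivrMr// /f; lra.
have c1' : 0 < 1 - c by rewrite subr_gt0.
have c1n : 1 - c != 0 by rewrite gt_eqF.
(* [s] is the ratio of the heights of [w] and [x] above the chord; the other
   two weights solve the inner products of the combination with [p] and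
   [q]. *)
exists s, ((1 - s - (dot w q - s * dot x q)) / (1 - c)),
  ((1 - s - (dot w p - s * dot x p)) / (1 - c)).
have xp0 : 0 <= 1 - dot x p by lra.
have xq0 : 0 <= 1 - dot x q by lra.
have e : dot w q = s * f - dot w p + (1 + c) by rewrite sf; ring.
split => //.
- by rewrite divr_ge0 ?(ltW c1')//; nra.
- by rewrite divr_ge0 ?(ltW c1')//; nra.
- by rewrite e /f; field.
- apply: (@dot_frame_inj _ p q); first by rewrite gt_eqF.
    by rewrite !dotE (dotC q p) pp -/c e /f; field.
  by rewrite !dotE qq -/c e /f; field.
Qed.

(** Consider a linear functional whose maximum on the unit circle is on the
    arc from [p] to [q]. Below the chord and under the two tangents it is
    largest at [p] or at [q], so a point where it is larger is beyond the
    chord. *)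
Lemma cap_detect s t x : 0 <= s -> 0 <= t ->
    dot x p <= 1 -> dot x q <= 1 ->
    dot p (s *: p + t *: q) < dot x (s *: p + t *: q) ->
    dot q (s *: p + t *: q) < dot x (s *: p + t *: q) -> beyond_chord p q x.
Proof.
rewrite /beyond_chord /= !dotE pp qq (dotC q p) -/c => s0 t0 xp xq h1 h2.
rewrite ltNge; apply/negP => h; have [st|st] := leP s t.
  have := mulr_ge0 s0 (_ : 0 <= 1 + c - (dot x p + dot x q)).
  have := mulr_ge0 (_ : 0 <= t - s) (_ : 0 <= 1 - dot x q).
  by rewrite !subr_ge0 => /(_ st xq) + /(_ h); lra.
have := mulr_ge0 t0 (_ : 0 <= 1 + c - (dot x p + dot x q)).
have := mulr_ge0 (_ : 0 <= s - t) (_ : 0 <= 1 - dot x p).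
by rewrite !subr_ge0 => /(_ (ltW st) xp) + /(_ h); lra.
Qed.

(** The point [r *: direction t] lies in the triangle with vertices [p], [q]
    and [direction t], so it cannot be beyond all three of them in the
    direction [n]. *)
Lemma cap_extreme n r t : 0 < r -> r <= 1 -> a < t < b ->
    beyond_chord p q (r *: direction t) -> dot n (direction t) < r * dot n (direction t) ->
    dot n p < r * dot n (direction t) -> dot n q < r * dot n (direction t) -> False.
Proof.
move=> r0 r1 atb /(cap_comb r0 atb)[i [j [i0 j0 ij E]]].
have := congr1 (dot n) E; rewrite !dotE; set m := r * _ => mE h1 h2 h3.
have hp : i * dot n p < i * m by rewrite ltr_pM2l.
have hq : j * dot n q < j * m by rewrite ltr_pM2l.
have : m < (i + j) * m by rewrite mulrDl {1}mE ltrD.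
rewrite -subr_gt0 -{2}(mul1r m) -mulrBl pmulr_rgt0 ?subr_gt0// => m0.
have D0 : 0 < dot n (direction t) by rewrite -(pmulr_rgt0 _ r0).
by have := ler_piMl (ltW D0) r1; rewrite -/m leNgt h1.
Qed.

End caps.

(** * Convex and compact plane sets *)

Section convex_compact.
Variable R : realType.
Implicit Types (x y z p q u v w e n : plane R) (r s t : R) (K L A B : set (plane R)).

Lemma convex_comb K x y s t : convex_set K -> K x -> K y ->
  0 <= s -> 0 <= t -> s + t = 1 -> K (s *: x + t *: y).
Proof.
move=> cK Kx Ky s0 t0 st.
have s1 : s <= 1 by lra.
have := cK x y (Itv01 s0 s1) (mem_set Kx) (mem_set Ky) => /set_mem.
by have -> : t = 1 - s by lra.
Qed.

Lemma convex_comb3 K x y z s t r : convex_set K -> K x -> K y -> K z ->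
  0 <= s -> 0 <= t -> 0 <= r -> s + t + r = 1 -> K (s *: x + t *: y + r *: z).
Proof.
move=> cK Kx Ky Kz s0 t0 r0 str.
have [r1|r1] := eqVneq r 1.
  have [-> ->] : s = 0 /\ t = 0 by lra.
  by rewrite !scale0r !add0r r1 scale1r.
have r1' : 0 < 1 - r by rewrite lt_neqAle subr_ge0 eq_sym subr_eq0 eq_sym r1/=; lra.
have -> : s *: x + t *: y = (1 - r) *: ((s / (1 - r)) *: x + (t / (1 - r)) *: y).
  by rewrite scalerDr !scalerA ![(1 - r) * _]mulrC !divfK ?gt_eqF.
apply: convex_comb => //; first apply: convex_comb => //; try lra.
- by rewrite divr_ge0// ltW.
- by rewrite divr_ge0// ltW.
- by rewrite -mulrDl (_ : s + t = 1 - r) ?divff ?gt_eqF//; lra.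
Qed.

Lemma convex_intro K :
  (forall x y s t, K x -> K y -> 0 <= s -> 0 <= t -> s + t = 1 ->
    K (s *: x + t *: y)) -> convex_set K.
Proof.
move=> H x y l /set_mem Kx /set_mem Ky; apply/mem_set; apply: H => //.
  by rewrite subr_ge0.
by rewrite addrC subrK.
Qed.

Lemma convex_half_plane u r : convex_set (half_plane u r).
Proof.
apply: convex_intro => x y s t; rewrite /half_plane /= => ux uy s0 t0 st.
rewrite !dotE; nra.
Qed.

Lemma continuous_dot n : continuous (dot n).
Proof.
move=> x; rewrite /dot; apply: cvgD; apply: cvgM; try exact: cvg_cst.
  exact: cvg_fst.
exact: cvg_snd.
Qed.

Lemma closed_half_plane u r : closed (half_plane u r).
Proof.
have -> : half_plane u r = dot u @^-1` [set t | t <= r] by [].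
by apply: preimage_closed; [move=> x _; exact: continuous_dot|exact: closed_le].
Qed.

Lemma compact_support_point K n : K !=set0 -> compact K ->
  exists2 x, K x & K `<=` half_plane n (dot n x).
Proof.
move=> K0 cK.
have [|x /set_mem Kx xmax] := compact_EVT_max K0 cK (f := dot n).
  by apply: continuous_subspaceT; exact: continuous_dot.
by exists x => // y Ky; apply: xmax; exact: mem_set.
Qed.

Lemma compact_minkowski_sum K L : compact K -> compact L ->
  compact (minkowski_sum K L).
Proof.
move=> cK cL.
have -> : minkowski_sum K L = (fun xy : plane R * plane R => xy.1 + xy.2) @` (K `*` L).
  apply/seteqP; split => [_ [x Kx [y Ly <-]]|_ [[x y] [Kx Ly] <-]].
    by exists (x, y).
  by exists x => //; exists y.
apply: continuous_compact; last exact: compact_setX.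
apply: continuous_subspaceT => xy; apply: cvgD; [exact: cvg_fst|exact: cvg_snd].
Qed.

Lemma compact_reflection K : compact K -> compact (reflection K).
Proof.
move=> cK; apply: continuous_compact => //.
by apply: continuous_subspaceT => x; apply: cvgN; exact: cvg_id.
Qed.

Lemma minkowski_sumS K K' L L' : K `<=` K' -> L `<=` L' ->
  minkowski_sum K L `<=` minkowski_sum K' L'.
Proof.
by move=> KK LL _ [x Kx [y Ly <-]]; exists x; [exact: KK|exists y => //; exact: LL].
Qed.

Lemma convex_minkowski_sum K L : convex_set K -> convex_set L ->
  convex_set (minkowski_sum K L).
Proof.
move=> cK cL; apply: convex_intro => _ _ s t [x Kx [y Ly <-]] [x' Kx' [y' Ly' <-]].
move=> s0 t0 st; exists (s *: x + t *: x'); first exact: convex_comb.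
exists (s *: y + t *: y'); first exact: convex_comb.
by rewrite !scalerDr addrACA.
Qed.

Lemma convex_reflection K : convex_set K -> convex_set (reflection K).
Proof.
move=> cK; apply: convex_intro => _ _ s t [x Kx <-] [y Ky <-] s0 t0 st.
exists (s *: x + t *: y); first exact: convex_comb.
by rewrite opprD !scalerN.
Qed.

Lemma minkowski_reflectionP K w : minkowski_sum K (reflection K) w <->
  exists x y, [/\ K x, K y & w = x - y].
Proof.
split=> [[x Kx [_ [y Ky <-] <-]]|[x [y [Kx Ky ->]]]]; first by exists x, y.
by exists x => //; exists (- y) => //; exists y.
Qed.

Lemma difference_bodyN K w : minkowski_sum K (reflection K) w ->
  minkowski_sum K (reflection K) (- w).
Proof.
move=> /minkowski_reflectionP[x [y [Kx Ky ->]]]; apply/minkowski_reflectionP.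
by exists y, x; rewrite opprB.
Qed.

(** The direction [e] leads from the point of [K] nearest to [x] towards
    [x]. *)
Lemma compact_separation K x : K !=set0 -> compact K -> convex_set K -> ~ K x ->
  exists e, forall y, K y -> dot e y < dot e x.
Proof.
move=> K0 cK xK Kx.
have [|z /set_mem Kz zmin] := compact_EVT_min K0 cK (f := fun z => dot (x - z) (x - z)).
  apply: continuous_subspaceT => z.
  apply: cvgD; apply: cvgM.
  - by apply: (@cvgB _ R^o _ _ _ (cst x.1) fst); [exact: cvg_cst|exact: cvg_fst].
  - by apply: (@cvgB _ R^o _ _ _ (cst x.1) fst); [exact: cvg_cst|exact: cvg_fst].
  - by apply: (@cvgB _ R^o _ _ _ (cst x.2) snd); [exact: cvg_cst|exact: cvg_snd].
  - by apply: (@cvgB _ R^o _ _ _ (cst x.2) snd); [exact: cvg_cst|exact: cvg_snd].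
exists (x - z) => y Ky.
have xz : 0 < dot (x - z) (x - z).
  by apply: dot_gt0; rewrite subr_eq0; apply: contra_notN Kx => /eqP->.
suff : dot (x - z) (y - z) <= 0.
  by move: xz; rewrite !dotE; lra.
rewrite leNgt; apply/negP; set k := dot _ _ => k0.
have D0 := dot_ge0 (y - z); set D := dot (y - z) (y - z) in D0.
have kD0 : 0 < k + D by lra.
(* Moving from [z] towards [y] by this fraction [s] would give a point of [K]
   nearer to [x], since [s * D < k]. *)
pose s := k / (k + D).
have sE : s * (k + D) = k by rewrite /s divfK// gt_eqF.
have s0 : 0 < s by rewrite divr_gt0.
have s1 : s <= 1 by rewrite ler_pdivrMr//; lra.
have /mem_set/zmin : K (s *: y + (1 - s) *: z) by apply: convex_comb => //; lra.
have -> : x - (s *: y + (1 - s) *: z) = (x - z) - s *: (y - z).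
  by rewrite scalerBl scale1r scalerBr addrCA opprD addrA.
rewrite !(dotDl (x - z)) !(dotDr _ (x - z)) !dotNl !dotNr !dotZl !dotZr.
by rewrite (dotC (y - z) (x - z)) -/k -/D; nra.
Qed.

(** The join of [v] and [A], which is the image of the compact set [ [0, 1] *
    A ]. Iterating this construction shows that the hull of finitely many
    points is compact. *)
Lemma convex_join_compact v A : A !=set0 -> compact A -> convex_set A ->
  exists B, [/\ compact B, convex_set B, B v, A `<=` B &
    forall K, convex_set K -> K v -> A `<=` K -> B `<=` K].
Proof.
move=> [a Aa] cA xA.
pose f (tz : R^o * plane R) : plane R := (1 - tz.1) *: v + tz.1 *: tz.2.
exists (f @` (`[0, 1] `*` A)); split.
- apply: continuous_compact; last by apply: compact_setX => //; exact: segment_compact.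
  apply: continuous_subspaceT => -[t z].
  apply: cvgD; apply: cvgZ; try exact: cvg_cst.
  + by apply: cvgB; [exact: cvg_cst|exact: cvg_fst].
  + exact: cvg_fst.
  + exact: cvg_snd.
- apply: convex_intro => _ _ i j [[t y] [/= t01 Ay] <-] [[t' y'] [/= t01' Ay'] <-].
  move=> i0 j0 ij; rewrite /f /=.
  move: t01 t01'; rewrite !in_itv /= => /andP[t0 t1] /andP[t0' t1'].
  have it0 := mulr_ge0 i0 t0; have jt0 := mulr_ge0 j0 t0'.
  (* If the total weight on [A] vanishes, the combination is [v]; any point of
     [A] can serve as second component. *)
  have [T0|T0] := eqVneq (i * t + j * t') 0.
    have [it jt] : i * t = 0 /\ j * t' = 0 by lra.
    exists (0, a); first by split => //=; rewrite in_itv /= lexx ler01.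
    rewrite /= subr0 scale1r scale0r addr0 !scalerDr !scalerA it jt !scale0r !addr0.
    rewrite -scalerDl -[LHS]scale1r; congr (_ *: _).
    by rewrite !mulrBr it jt !mulr1; lra.
  have T1 : 0 < i * t + j * t' by rewrite lt_def T0/= addr_ge0.
  exists (i * t + j * t',
    ((i * t) / (i * t + j * t')) *: y + ((j * t') / (i * t + j * t')) *: y').
    split=> /=; first by rewrite in_itv /=; nra.
    apply: convex_comb => //; rewrite ?divr_ge0//; first exact: ltW.
      exact: ltW.
    by rewrite -mulrDl divff.
  rewrite /= !scalerDr !scalerA ![_ * (_ / _)]mulrC !divfK//.
  rewrite addrACA -scalerDl; congr (_ *: _ + _).
  by rewrite !mulrBr !mulr1; lra.
- exists (0, a); first by split => //=; rewrite in_itv /= lexx ler01.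
  by rewrite /f /= subr0 scale1r scale0r addr0.
- move=> z Az; exists (1, z); first by split => //=; rewrite in_itv /= lexx ler01.
  by rewrite /f /= subrr scale0r scale1r add0r.
- move=> K xK Kv AK _ [[t z] [/= t01 Az] <-]; rewrite /f /=.
  move: t01; rewrite in_itv /= => /andP[t0 t1].
  by apply: convex_comb => //; [exact: AK|lra|lra].
Qed.

Lemma seq_hull_body v (s : seq (plane R)) :
  exists B, [/\ B v, compact B, convex_set B, [set` s] `<=` B &
    forall K, convex_set K -> K v -> [set` s] `<=` K -> B `<=` K].
Proof.
elim: s => [|x s [B [Bv cB xB sB minB]]].
  exists [set v]; split => //; first exact: compact_set1.
    apply: convex_intro => _ _ s t -> -> s0 t0 st.
    by rewrite /= -scalerDl st scale1r.
  by move=> K _ Kv _ _ ->.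
have [|A [cA xA Ax BA minA]] := @convex_join_compact x B _ cB xB; first by exists v.
exists A; split => //; first exact: BA.
  by move=> z /=; rewrite in_cons => /orP[/eqP->//|zs]; apply/BA/sB.
move=> K xK Kv sK; apply: minA => //; first by apply: sK; rewrite /= mem_head.
by apply: minB => // z zs; apply: sK; rewrite /= in_cons; apply/orP; right.
Qed.

Lemma convex_hull_fin_body m (f : 'I_m -> plane R) : (0 < m)%N ->
  convex_body (convex_hull (range f)).
Proof.
move=> m0; have [B [Bv cB xB sB minB]] :=
  seq_hull_body (f (Ordinal m0)) [seq f i | i <- enum 'I_m].
suff -> : convex_hull (range f) = B by split => //; exists (f (Ordinal m0)).
apply/seteqP; split.
  apply: smallest_sub => // _ [i _ <-]; apply: sB => /=.
  by apply: map_f; rewrite mem_enum.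
move=> x Bx K [xK fK]; apply: minB Bx => //; first by apply: fK; exists (Ordinal m0).
by move=> _ /= /mapP[i _ ->]; apply: fK; exists i.
Qed.

(** A parallelogram is the affine image of a product of two segments. *)
Lemma compact_frame_box z p q r s r' s' : cross p q != 0 ->
  compact [set x | r <= dot (x - z) p <= s /\ r' <= dot (x - z) q <= s'].
Proof.
move=> pq.
pose u : plane R := (q.2 / cross p q, - q.1 / cross p q).
pose v : plane R := (- p.2 / cross p q, p.1 / cross p q).
pose f (ij : R^o * R^o) : plane R := z + (ij.1 *: u + ij.2 *: v).
suff -> : [set x | r <= dot (x - z) p <= s /\ r' <= dot (x - z) q <= s'] =
    f @` (`[r, s] `*` `[r', s']).
  apply: continuous_compact; last by apply: compact_setX => //; exact: segment_compact.
  apply: continuous_subspaceT => ij; rewrite /f.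
  apply: cvgD; first exact: cvg_cst.
  by apply: cvgD; apply: cvgZ; (exact: cvg_cst || exact: cvg_fst || exact: cvg_snd).
have [up uq vp vq] : [/\ dot u p = 1, dot u q = 0, dot v p = 0 & dot v q = 1].
  by move: pq; rewrite /u /v /dot /cross /= => pq; split; field; exact: pq.
have fp ij : dot (f ij - z) p = ij.1.
  by rewrite /f addrC addKr !dotE up vp; lra.
have fq ij : dot (f ij - z) q = ij.2.
  by rewrite /f addrC addKr !dotE uq vq; lra.
apply/seteqP; split => [x /= [xp xq]|_ [[i j] [/= ii jj] <-]].
  exists (dot (x - z) p, dot (x - z) q); first by rewrite /= !in_itv.
  by apply: (addIr (- z)); apply: (dot_frame_inj pq); rewrite ?fp ?fq.
by rewrite fp fq; move: ii jj; rewrite !in_itv.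
Qed.

End convex_compact.

(** * Area *)

Section plane_area.
Variable R : realType.
Implicit Types (x y z u c w : plane R) (K L : set (plane R)).

Local Notation lborel := (@lebesgue_measure R).
Local Notation mu := (lborel \x lborel)%E.
Local Notation bplane := (measurableTypeR R * measurableTypeR R)%type.

(** The area is taken on the product of two copies of the line with its Borel
    sets, whereas open and compact sets refer to the product topology; this
    names measurability in the former sense for subsets of the topological
    plane. *)
Definition borel_plane K : Prop := @measurable _ bplane K.

Lemma borel_box (a b a' b' : R) : borel_plane (`]a, b[%classic `*` `]a', b'[%classic).
Proof. by apply: measurableX; exact: measurable_itv. Qed.

(** An open set is the union of the countably many squares with rational
    centre and half side [1 / (k + 1)] that it contains. *)
Lemma open_borel_plane K : open K -> borel_plane K.
Proof.
move=> oK.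
pose box (k : rat * rat * nat) : set (plane R) :=
  `]ratr k.1.1 - k.2.+1%:R^-1, ratr k.1.1 + k.2.+1%:R^-1[%classic `*`
  `]ratr k.1.2 - k.2.+1%:R^-1, ratr k.1.2 + k.2.+1%:R^-1[%classic.
have -> : K = \bigcup_k (if `[< box k `<=` K >] then box k else set0).
  apply/seteqP; split => [x Kx|x [k _]]; last by case: asboolP => // kK /kK.
  have /nbhs_ballP[e /= e0 eK] : nbhs x K by exact: oK.
  have e20 : 0 < e / 2 by rewrite divr_gt0.
  have [N _ /(_ N (leqnn N))] := near_infty_natSinv_lt (PosNum e20).
  have : 0 < N.+1%:R^-1 :> R by rewrite invr_gt0.
  have [d dE] : exists d : R, N.+1%:R^-1 = d by exists N.+1%:R^-1.
  rewrite dE /= => d0 Ne.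
  have approx (z : R) : exists q, z - d < ratr q < z + d.
    have [|q] := @rat_in_itvoo R (z - d) (z + d); first lra.
    by rewrite in_itv /= => qz; exists q.
  have [q1 /andP[q1l q1r]] := approx x.1.
  have [q2 /andP[q2l q2r]] := approx x.2.
  exists (q1, q2, N) => //.
  case: asboolP => [_|].
    by split; rewrite /= in_itv /= dE; apply/andP; split; lra.
  case=> -[y1 y2] [/=]; rewrite !in_itv /= !dE /= => y1q y2q; apply: eK.
  by split; rewrite /ball /= ltr_norml; lra.
apply: countable_bigcupT_measurable; first exact: countableP.
by move=> k; case: ifP => // _; exact: borel_box.
Qed.

Lemma closed_borel_plane K : closed K -> borel_plane K.
Proof.
move=> cK; rewrite -[K]setCK; apply: measurableC; apply: open_borel_plane.
exact: closed_openC.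
Qed.

Lemma compact_borel_plane K : compact K -> borel_plane K.
Proof.
move=> cK; apply: closed_borel_plane; apply: compact_closed cK.
exact: norm_hausdorff.
Qed.

Lemma borel_half_plane_gt (u : plane R) (r : R) : borel_plane [set x | r < dot x u].
Proof.
apply: open_borel_plane; have -> : [set x | r < dot x u] = dot u @^-1` [set t | r < t].
  by apply/seteqP; split=> x /=; rewrite dotC.
apply: open_comp; last exact: open_gt.
by move=> x _; exact: continuous_dot.
Qed.

Lemma lebesgue_translation (c : R) (A : set (measurableTypeR R)) : measurable A ->
  lborel ((fun t : R => c + t) @^-1` A) = lborel A.
Proof.
move=> mA.
pose f (t : measurableTypeR R) : measurableTypeR R := (c + t)%R.
have mf : measurable_fun setT f.
  apply: continuous_measurable_fun => t; apply: cvgD; [exact: cvg_cst|exact: cvg_id].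
rewrite -[LHS]/(pushforward lborel f A).
apply/esym/lebesgue_measure_unique => //= _ [[a b]] _ <-.
have -> : pushforward lborel f `](a, b).1, (a, b).2]%classic =
    lborel `](a - c), (b - c)]%classic.
  congr (lborel _); apply/seteqP.
  by split => t /=; rewrite !in_itv /= ltrBlDl lerBrDl.
rewrite !lebesgue_measure_itv /= !lte_fin ltrD2r.
by case: ifP => // _; congr (_%:E); rewrite /=; lra.
Qed.

Lemma product_measure_preserving (f1 f2 : measurableTypeR R -> measurableTypeR R) K :
  measurable_fun setT f1 -> measurable_fun setT f2 ->
  (forall A, measurable A -> lborel (f1 @^-1` A) = lborel A) ->
  (forall A, measurable A -> lborel (f2 @^-1` A) = lborel A) ->
  borel_plane K -> mu ((fun x : bplane => (f1 x.1, f2 x.2)) @^-1` K) = mu K.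
Proof.
move=> mf1 mf2 pf1 pf2 mK.
pose f (x : bplane) : bplane := (f1 x.1, f2 x.2).
have mf : measurable_fun setT f.
  by apply: measurable_fun_pair; apply: measurableT_comp.
rewrite -[LHS]/(pushforward mu f K).
apply/esym/product_measure_unique => //= A B mA mB.
have mpre (h : measurableTypeR R -> measurableTypeR R) D :
    measurable_fun setT h -> measurable D -> measurable (h @^-1` D).
  by move=> mh mD; rewrite -[X in measurable X]setTI; exact: mh.
have -> : pushforward mu f (A `*` B) = mu ((f1 @^-1` A) `*` (f2 @^-1` B)) by [].
rewrite product_measure1E; [|exact: mpre mf1 mA|exact: mpre mf2 mB].
by congr (_ * _)%E; [exact: pf1|exact: pf2].
Qed.

Lemma area_translation c K : borel_plane K -> area [set x | K (c + x)] = area K.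
Proof.
move=> mK; rewrite /area; congr fine.
have mt (t : R) : measurable_fun setT
    ((fun s : R => t + s) : measurableTypeR R -> measurableTypeR R).
  by apply: continuous_measurable_fun => s; apply: cvgD; [exact: cvg_cst|exact: cvg_id].
by apply: (product_measure_preserving (mt c.1) (mt c.2) _ _ mK); exact: lebesgue_translation.
Qed.

Lemma area_reflection K : borel_plane K -> area (reflection K) = area K.
Proof.
move=> mK; rewrite /area; congr fine.
have -> : reflection K = [set x | K (- x)].
  apply/seteqP; split => [_ [x Kx <-]|x Kx]; rewrite /= ?opprK//.
  by exists (- x); rewrite ?opprK.
have mt : measurable_fun setT (-%R : measurableTypeR R -> measurableTypeR R).
  exact: oppr_measurable.
by apply: (product_measure_preserving mt mt _ _ mK); exact: lebesgue_measureN.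
Qed.

Lemma compact_finite_area K : compact K -> (mu K < +oo)%E.
Proof.
move=> cK; have [M [_ KM]] := compact_bounded cK.
pose r := `|M| + 1.
have Kr : K `<=` `[- r, r]%classic `*` `[- r, r]%classic.
  move=> x Kx; have : `|x| <= r.
    by apply: KM => //; rewrite /r (le_lt_trans (ler_norm _))// ltrDl.
  rewrite /Num.norm /= ge_max => /andP[x1 x2].
  by split; rewrite /= in_itv /= -ler_norml.
have mI : measurable (`[- r, r]%classic : set (measurableTypeR R)) by exact: measurable_itv.
apply: (@le_lt_trans _ _ (mu (`[- r, r]%classic `*` `[- r, r]%classic))).
  apply: le_measure => //; rewrite inE; last exact: measurableX.
  by apply: closed_borel_plane; apply: compact_closed => //; exact: norm_hausdorff.
rewrite product_measure1E//= !lebesgue_measure_itv /=.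
by case: ifP => _; rewrite ?mule0 ?ltry// -EFinD -EFinM ltry.
Qed.

Lemma area_partition (I : finType) K (F : I -> set (plane R)) :
    borel_plane K -> (mu K < +oo)%E -> (forall i, borel_plane (F i)) ->
    (forall i j x, K x -> F i x -> F j x -> i = j) ->
  area K = area (K `\` \bigcup_i F i) + \sum_i area (K `&` F i).
Proof.
move=> mK fK mF dF.
have finI : finite_set [set: I] by exact: finite_finset.
have mUF : borel_plane (\bigcup_i F i).
  by apply: fin_bigcup_measurable => [|i _]; [exact: finI|exact: mF].
have mKF i : borel_plane (K `&` F i) by apply: measurableI; [exact: mK|exact: mF].
have fin A : borel_plane A -> A `<=` K -> mu A \is a fin_num.
  move=> mA AK; rewrite ge0_fin_numE//; apply: le_lt_trans fK.
  by apply: le_measure => //; rewrite inE.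
rewrite /area (measureDI mu mK mUF) fineD; last 2 first.
- by apply: fin; [exact: measurableD|exact: subDsetl].
- by apply: fin; [exact: measurableI|exact: subIsetl].
congr (_ + _); rewrite setI_bigcupr measure_fin_bigcup.
- have -> : [set: I] = [set` index_enum I].
    by apply/seteqP; split => i // _; exact: mem_index_enum.
  rewrite -fsbig_seq ?index_enum_uniq// -sum_fine// => i _.
  by apply: fin => //; exact: subIsetl.
- exact: finI.
- by move=> i j _ _ [x [[Kx Fi] [_ Fj]]]; exact: dF Kx Fi Fj.
- by move=> i _; exact: mKF.
Qed.

End plane_area.

(** * Normals of a Reuleaux polygon *)

Section one_sided.
Variable R : realType.

(** The derivative at 0 of [A cos s + B sin s] is [B]. By the double angle
    formulas the hypothesis at [s + s] reads [B cos s <= A sin s], and the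
    limit at 0 gives the claim. *)
Lemma right_slope_le0 (A B d : R) : 0 < d ->
  (forall s, 0 < s < d -> A * cos s + B * sin s <= A) -> B <= 0.
Proof.
move=> d0 H; rewrite leNgt; apply/negP => B0.
have cf : (fun s : R => B * cos s - A * sin s) @ (0:R)^'+ --> B * cos 0 - A * sin 0.
  apply: cvg_at_right_filter; apply: cvgB; apply: cvgM; try exact: cvg_cst.
    exact: continuous_cos.
  exact: continuous_sin.
rewrite cos0 sin0 mulr1 mulr0 subr0 in cf.
suff : B <= 0 by lra.
rewrite -(cvg_lim (@Rhausdorff R) cf); apply: limr_le; first by apply/cvg_ex; exists B.
near=> s.
have s0 : 0 < s by near: s; exact: nbhs_right_gt.
have sd : s * 2 < d.
  by rewrite -ltr_pdivlMr//; near: s; apply: nbhs_right_lt; rewrite divr_gt0.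
have spi : s < pi by near: s; apply: nbhs_right_lt; exact: pi_gt0.
have ss : 0 < sin s by rewrite sin_gt0_pi// s0.
have := H (s + s); rewrite cosD sinD => /(_ _).
have -> : 0 < s + s < d by apply/andP; split; lra.
move=> /(_ isT) H2.
have cs : A * (cos s ^+ 2 + sin s ^+ 2) = A by rewrite cos2Dsin2 mulr1.
have H3 : sin s * (B * cos s - A * sin s) <= 0 by lra.
by rewrite -(pmulr_rle0 _ ss).
Unshelve. all: by end_near.
Qed.

End one_sided.

Section reuleaux.
Variables (R : realType) (P : set (plane R)) (n : nat) (g : 'I_n -> unit_arc R).
Hypothesis hP : reuleaux_polygon P g.
Implicit Types (x y z u v w e : plane R) (r s t : R) (i j : 'I_n) (K : set (plane R)).

Local Notation cen i := (arc_center (g i)).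
Local Notation a i := (arc_start (g i)).
Local Notation b i := (arc_stop (g i)).
Local Notation p i := (direction (arc_start (g i))).
Local Notation q i := (direction (arc_stop (g i))).
Local Notation C := (tangent_polygon P g).
Local Notation S := (skeleton_polygon g).
Local Notation normal e y := (P `<=` half_plane e (dot e y)).

(** The two supporting lines orthogonal to [x - y] are at distance 1, and [x]
    and [y] lie between them. *)
Lemma reuleaux_diameter x y : P x -> P y -> dot (x - y) (x - y) <= 1.
Proof.
move=> Px Py; have [->|xy] := eqVneq x y; first by rewrite subrr /dot /= !mul0r addr0.
have [P0 cP _] := reuleaux_body hP.
pose u := x - y; have u0 : u != 0 by rewrite subr_eq0.
have uu := dot_gt0 u0.
have [X PX Xmax] := compact_support_point u P0 cP.
have [Y PY Ymax] := compact_support_point (- u) P0 cP.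
have Xx : dot u x <= dot u X by exact: Xmax.
have Yy : dot u Y <= dot u y by have := Ymax _ Py; rewrite /half_plane /= !dotNl lerN2.
have uE : dot u u = dot u x - dot u y by rewrite {2}/u dotDr dotNr.
have XY : dot u X != dot u Y by apply/eqP; lra.
have sX : supports u (dot u X) P by split; [exists X|left].
have sY : supports u (dot u Y) P.
  by split; [exists Y|right; move=> z /Ymax; rewrite /half_plane /= !dotNl].
have dist1 := reuleaux_width hP u0 XY sX sY.
have : enorm u <= 1.
  rewrite -dist1; apply: lb_le_inf.
    by exists (enorm (X - Y)); exists X => //; exists Y.
  move=> _ [A /= AX [B /= BY <-]]; rewrite ler_sqrt ?dot_ge0//.
  have := lagrange_identity u (A - B).
  have : dot u u <= dot u (A - B) by rewrite dotDr dotNr AX BY; lra.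
  have := sqr_ge0 (cross u (A - B)); have := uu.
  move: (dot u u) (dot u (A - B)) (cross _ _) (dot (A - B) _) => U V c W U0 c0 UV E.
  rewrite -(ler_pM2l U0); nra.
rewrite /enorm -{1}sqrtr1 ler_sqrt//.
Qed.

Lemma reuleaux_closed : closed P.
Proof.
have [_ cP _] := reuleaux_body hP; apply: compact_closed cP.
exact: norm_hausdorff.
Qed.

(** Arcs lie in the boundary of [P], and [P] is closed. *)
Lemma arc_in i t : a i <= t <= b i -> P (arc_point (g i) t).
Proof.
move=> abt; have [+ _] : boundary P (arc_point (g i) t).
  by rewrite (reuleaux_boundary hP); exists i => //; exists t => //=; rewrite in_itv.
by rewrite -(closure_id P).1//; exact: reuleaux_closed.
Qed.

Lemma start_lt_stop i : a i < b i.
Proof. by have /andP[] := reuleaux_arc hP i. Qed.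

Lemma source_in i : P (arc_source (g i)).
Proof. by apply: arc_in; rewrite lexx ltW// start_lt_stop. Qed.

Lemma center_vertex i : exists j, cen i = arc_source (g j).
Proof. by have [j _ E] := reuleaux_center hP i; exists j. Qed.

Lemma center_in i : P (cen i).
Proof. by have [j E] := center_vertex i; rewrite E; exact: source_in. Qed.

(** An arc of length at least [pi] would contain two opposite points of its
    circle, at distance 2. *)
Lemma arc_span i : 0 < b i - a i < pi.
Proof.
rewrite subr_gt0 start_lt_stop /= ltNge; apply/negP => abpi.
have h1 : P (cen i + direction (a i)) by exact: source_in.
have h2 : P (cen i + direction (a i + pi)).
  by apply: arc_in; have := pi_gt0 R; lra.
have := reuleaux_diameter h1 h2.
rewrite direction_half_turn opprD opprK addrACA subrr add0r !dotE dot_directionv; lra.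
Qed.

(** Since the centre is in [P], the diameter bound puts [P] in the unit disc
    about it, and this disc is on one side of its tangents. *)
Lemma arc_half_plane i t :
  P `<=` half_plane (direction t) (dot (direction t) (arc_point (g i) t)).
Proof.
move=> x Px.
rewrite /half_plane /= /arc_point dotDr dot_directionv -lerBlDl -dotNr -dotDr.
apply: dot_le1; first by rewrite dot_directionv.
exact: reuleaux_diameter Px (center_in i).
Qed.

(** The opposite supporting line of the previous one: [P] is also in the unit
    disc about the point of the arc. *)
Lemma center_half_plane i t : a i <= t <= b i ->
  P `<=` half_plane (- direction t) (dot (- direction t) (cen i)).
Proof.
move=> abt x Px; rewrite /half_plane /= !dotNl lerN2.
have : dot (direction t) (arc_point (g i) t - x) <= 1.
  apply: dot_le1; first by rewrite dot_directionv.
  exact: reuleaux_diameter (arc_in abt) Px.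
rewrite /arc_point dotDr dotDr dotNr dot_directionv; lra.
Qed.

(** A linear functional that is maximal on [P] at a point of an arc cannot
    increase along the arc. *)
Lemma arc_slope_le0 i t e : a i <= t < b i -> normal e (arc_point (g i) t) ->
  cross (direction t) e <= 0.
Proof.
move=> /andP[at_ tb] ne.
apply: (@right_slope_le0 _ (dot e (direction t)) _ (b i - t)); first by rewrite subr_gt0.
move=> s /andP[s0 sb]; have /ne : P (arc_point (g i) (t + s)) by apply: arc_in; lra.
rewrite /half_plane /= /arc_point !dotDr lerD2l -/(direction (t + s)) direction_rotate !dotE.
by rewrite /cross /dot /= ; lra.
Qed.

Lemma arc_slope_ge0 i t e : a i < t <= b i -> normal e (arc_point (g i) t) ->
  0 <= cross (direction t) e.
Proof.
move=> /andP[at_ tb] ne; rewrite -oppr_le0.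
apply: (@right_slope_le0 _ (dot e (direction t)) _ (t - a i)); first by rewrite subr_gt0.
move=> s /andP[s0 sb]; have /ne : P (arc_point (g i) (t + - s)) by apply: arc_in; lra.
rewrite /half_plane /= /arc_point !dotDr lerD2l -/(direction (t + - s)).
rewrite direction_rotate !dotE cosN sinN.
by rewrite /cross /dot /= ; lra.
Qed.

Lemma source_tangent i x : C x -> dot (p i) x <= dot (p i) (arc_source (g i)).
Proof.
have E : arc_source (g i) - arc_center (g i) = p i by rewrite addrC addKr.
move=> /(_ (p i) (dot (p i) (arc_source (g i)))); apply.
- exact: direction_neq0.
- exact: arc_half_plane.
- by exists i; left; rewrite /tangent_line E.
Qed.

Lemma target_tangent i x : C x -> dot (q i) x <= dot (q i) (arc_target (g i)).
Proof.
have E : arc_target (g i) - arc_center (g i) = q i by rewrite addrC addKr.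
move=> /(_ (q i) (dot (q i) (arc_target (g i)))); apply.
- exact: direction_neq0.
- exact: arc_half_plane.
- by exists i; right; rewrite /tangent_line E.
Qed.

(** A normal of [P] at a vertex is maximal there along both arcs that meet at
    the vertex. This forces it to be a nonnegative combination of the radial
    directions [q l] and [p j] of these arcs. The tangents of both arcs bound
    [C], so the vertex also maximises that combination on [C]. The two radii
    may coincide, if the arcs are on the same circle; they cannot be opposite,
    because the two tangents would then confine [P] to a line that misses the
    centres. *)
Lemma vertex_normal j e x : normal e (arc_source (g j)) -> C x ->
  dot e x <= dot e (arc_source (g j)).
Proof.
move=> ne Cx; pose l := ord_pred j.
have vE : arc_target (g l) = arc_source (g j).
  by rewrite (reuleaux_consecutive hP) /l ord_predK.
have ab_l := start_lt_stop l; have ab_j := start_lt_stop j.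
have xp := source_tangent j Cx; have xq := target_tangent l Cx.
rewrite vE in xq.
have pe : cross (p j) e <= 0 by apply: arc_slope_le0 ne; rewrite lexx.
have qe : 0 <= cross (q l) e.
  by apply: (@arc_slope_ge0 l) => //; [rewrite lexx andbT|rewrite -/(arc_target _) vE].
have np : normal (p j) (arc_source (g j)) by exact: arc_half_plane.
have qp : 0 <= cross (q l) (p j).
  by apply: (@arc_slope_ge0 l) => //; [rewrite lexx andbT|rewrite -/(arc_target _) vE].
have cE z : dot z (cen j) = dot z (arc_source (g j)) - dot z (p j).
  by rewrite -dotNr -dotDr /arc_source /arc_point addrK.
rewrite -subr_ge0 -dotNr -dotDr.
rewrite -subr_ge0 -dotNr -dotDr in xp; rewrite -subr_ge0 -dotNr -dotDr in xq.
(* Otherwise the two radii are parallel; they agree because the centre of arc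
   [j] satisfies the tangent inequality of arc [l]. *)
have [qp0|qp0] := ltP 0 (cross (q l) (p j)).
  rewrite (cross_frame e (lt0r_neq0 qp0)) dotDl !dotZl addr_ge0// mulr_ge0// divr_ge0//.
  by move: pe; rewrite /cross; lra.
have {}qp0 : cross (q l) (p j) = 0 by lra.
have qpd : 0 <= dot (q l) (p j).
  have : P `<=` half_plane (q l) (dot (q l) (arc_target (g l))).
    exact: arc_half_plane.
  move=> /(_ _ (center_in j)); rewrite vE /half_plane /= cE; lra.
have pq : p j = q l.
  apply/esym/dot_eq1; rewrite ?dot_directionv//.
  have := lagrange_identity (q l) (p j); rewrite !dot_directionv qp0; nra.
have pe0 : cross (p j) e = 0 by apply/le_anti; rewrite pe pq qe.
rewrite (parallel_unit (dot_directionv _) pe0) dotZl mulr_ge0//.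
have := ne _ (center_in j); rewrite /half_plane /= cE; lra.
Qed.

(** At an interior point of an arc the slope of the functional along the arc
    vanishes, so that the normal is radial; it points outwards because the
    centre is in [P]. *)
Lemma open_arc_normal i t e : a i < t < b i -> normal e (arc_point (g i) t) ->
  exists2 r, 0 <= r & e = r *: direction t.
Proof.
move=> /andP[at_ tb] ne; exists (dot e (direction t)).
  have := ne _ (center_in i); rewrite /half_plane /= /arc_point dotDr -/(direction t); lra.
apply: parallel_unit; first exact: dot_directionv.
apply/le_anti; rewrite (arc_slope_le0 _ ne) ?(arc_slope_ge0 _ ne)// ?at_ ?tb ?(ltW at_) ?(ltW tb)//.
Qed.

(** If the source of arc [j] were inside arc [i], its only normal there would
    be the radius of arc [i], so that both arcs would have the same centre.
    They would then run along the same circle for a while, which disjointness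
    excludes. *)
Lemma source_notin_open_arc i j : ~ open_arc (g i) (arc_source (g j)).
Proof.
move=> [t]; rewrite /= in_itv /= => /andP[at_ tb] tE.
have ab_j := start_lt_stop j.
have np : normal (p j) (arc_source (g j)) by exact: arc_half_plane.
have [r r0 pE] : exists2 r, 0 <= r & p j = r *: direction t.
  by apply: (@open_arc_normal i); rewrite ?tE// at_ tb.
have r1 : r = 1.
  have := dot_directionv (a j); rewrite pE !dotE dot_directionv; nra.
have {}pE : direction (a j) = direction t :> plane R by rewrite pE r1 scale1r.
have cE : arc_center (g i) = arc_center (g j).
  by apply: (addIr (direction t)); rewrite -[RHS]/(_ + _) -{2}pE.
have [ij|/(reuleaux_disjoint hP)] := eqVneq i j.
  have : 0 < cross (direction (a j)) (direction t : plane R).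
    rewrite cross_direction; apply: sin_gt0_pi; have := arc_span i; rewrite -ij.
    by move: at_ tb; lra.
  by rewrite pE cross_direction subrr sin0 ltxx.
(* Advancing by the angle [s] stays inside both arcs. *)
pose s := Num.min (b j - a j) (b i - t) / 2.
have m0 : 0 < Num.min (b j - a j) (b i - t) by rewrite lt_min !subr_gt0 ab_j.
have s0 : 0 < s by rewrite divr_gt0.
have : s < Num.min (b j - a j) (b i - t) by rewrite /s; lra.
rewrite lt_min => /andP[s1 s2].
rewrite -subset0 => /(_ (arc_point (g i) (t + s))); apply; split.
  by exists (t + s) => //=; rewrite in_itv /=; move: at_; lra.
exists (a j + s); first by rewrite /= in_itv /=; lra.
case: pE => ca sa.
by rewrite /arc_point cE !cosD !sinD ca sa.
Qed.

Lemma polygon_sub_tangent : P `<=` C.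
Proof. by move=> x Px u c _ Pu _; exact: Pu. Qed.

(** The upper bound is the tangent at the source of the arc. The lower bound
    is the line through the centre orthogonal to [p i]: it supports [P] there,
    and the centre is a vertex, so [vertex_normal] extends the bound to
    [C]. *)
Lemma tangent_p_bounds i x : C x -> 0 <= dot (x - cen i) (p i) <= 1.
Proof.
move=> Cx; have ab_i := start_lt_stop i; apply/andP; split; last first.
  have := source_tangent i Cx; rewrite /arc_source /arc_point dotDr dot_directionv.
  rewrite !(dotC _ (p i)) dotDr dotNr; lra.
have [j cE] := center_vertex i.
have : normal (- p i) (arc_source (g j)).
  by rewrite -cE; apply: center_half_plane; rewrite lexx ltW.
move=> /vertex_normal/(_ Cx); rewrite -cE !(dotC _ (p i)) dotDr !dotNr !dotNl; lra.
Qed.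

Lemma tangent_q_bounds i x : C x -> 0 <= dot (x - cen i) (q i) <= 1.
Proof.
move=> Cx; have ab_i := start_lt_stop i; apply/andP; split; last first.
  have := target_tangent i Cx; rewrite /arc_target /arc_point dotDr dot_directionv.
  rewrite !(dotC _ (q i)) dotDr dotNr; lra.
have [j cE] := center_vertex i.
have : normal (- q i) (arc_source (g j)).
  by rewrite -cE; apply: center_half_plane; rewrite lexx ltW.
move=> /vertex_normal/(_ Cx); rewrite -cE !(dotC _ (q i)) dotDr !dotNr !dotNl; lra.
Qed.

(** An interior point could be moved a little in the direction [e]. *)
Lemma normal_boundary e y : e != 0 -> P y -> normal e y -> boundary P y.
Proof.
move=> e0 Py ne; split; first exact: subset_closure.
move=> /= yP.
have cf : (fun s : R => y + s *: e) @ (0:R)^'+ --> y + 0 *: e.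
  apply: cvg_at_right_filter; apply: cvgD; first exact: cvg_cst.
  by apply: cvgZ; [exact: cvg_id|exact: cvg_cst].
rewrite scale0r addr0 in cf.
have [s [s0 /ne]] := filter_ex (filterI (nbhs_right_gt (0 : R)) (cf _ yP)).
rewrite /half_plane /= !dotE gerDl leNgt mulr_gt0//; exact: dot_gt0.
Qed.

Lemma boundary_cases y : boundary P y ->
  (exists i, y = arc_source (g i)) \/ (exists i, open_arc (g i) y).
Proof.
rewrite (reuleaux_boundary hP) => -[i _ [t]]; rewrite /= in_itv /= => /andP[at_ tb] <-.
have [->|ta] := eqVneq t (a i); first by left; exists i.
have [->|tb'] := eqVneq t (b i).
  by left; exists (ordS i); rewrite -(reuleaux_consecutive hP).
by right; exists i, t => //; rewrite /= in_itv /= !lt_neqAle at_ tb eq_sym ta tb'.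
Qed.

(** A direction attains its maximum over [P] either at a vertex, which then
    also maximises it over the larger set [C], or inside an arc, and then the
    direction lies in the sector of that arc. *)
Lemma support_cases e y : e != 0 -> P y -> normal e y ->
  (forall x, C x -> dot e x <= dot e y) /\ (exists i, y = arc_source (g i)) \/
  exists i s t, [/\ 0 <= s, 0 <= t & e = s *: p i + t *: q i].
Proof.
move=> e0 Py ne; case: (boundary_cases (normal_boundary e0 Py ne)) => [[i yE]|[i]].
  left; split; last by exists i.
  by move=> x Cx; rewrite yE; apply: vertex_normal; rewrite -?yE.
move=> [t]; rewrite /= in_itv /= => atb yE; right; exists i.
rewrite -yE in ne.
have [r r0 eE] := open_arc_normal atb ne.
have [s [s' [s0 s0' tE]]] := sector_comb (arc_span i) atb.
exists (r * s), (r * s'); split.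
- by rewrite mulr_ge0// ltW.
- by rewrite mulr_ge0// ltW.
- by rewrite eE tE scalerDr !scalerA.
Qed.

(** * The caps of the tangent polygon *)

Lemma source_skeleton i : S (arc_source (g i)).
Proof. by move=> K [_ vK]; apply: vK; exists i. Qed.

Lemma target_skeleton i : S (arc_target (g i)).
Proof. by rewrite (reuleaux_consecutive hP); exact: source_skeleton. Qed.

Lemma center_skeleton i : S (cen i).
Proof. by have [j ->] := center_vertex i; exact: source_skeleton. Qed.

Lemma reuleaux_gt0 : (0 < n)%N.
Proof. by apply: leq_trans (reuleaux_ge3 hP). Qed.

Lemma skeleton_body : convex_body S.
Proof. exact: convex_hull_fin_body reuleaux_gt0. Qed.

Lemma skeleton_sub_polygon : S `<=` P.
Proof.
have [_ _ cP] := reuleaux_body hP.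
by apply: smallest_sub => // _ [i _ <-]; exact: source_in.
Qed.

Lemma tangent_convex : convex_set C.
Proof.
apply: convex_intro => x y s t Cx Cy s0 t0 st u c u0 Pu tu.
by apply: (convex_comb (@convex_half_plane _ u c)) => //; [exact: Cx|exact: Cy].
Qed.

Lemma tangent_closed : closed C.
Proof.
have -> : C = \bigcap_(uc in [set uc : plane R * R | [/\ uc.1 != 0,
    P `<=` half_plane uc.1 uc.2 & exists i,
      line uc.1 uc.2 = tangent_line (g i) (arc_source (g i)) \/
      line uc.1 uc.2 = tangent_line (g i) (arc_target (g i))]]) half_plane uc.1 uc.2.
  apply/seteqP; split => [x Cx [u c] [/= u0 Pu tu]|x Cx u c u0 Pu tu]; first exact: Cx.
  by apply: (Cx (u, c)).
by apply: closed_bigI => -[u c] _; exact: closed_half_plane.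
Qed.

(** The bounds along [p i] and [q i] for a single arc confine [C] to a
    parallelogram. *)
Lemma tangent_body : convex_body C.
Proof.
split; last exact: tangent_convex.
  by have [[x Px] _ _] := reuleaux_body hP; exists x; exact: polygon_sub_tangent.
pose i := Ordinal reuleaux_gt0.
have pq : cross (p i) (q i) != 0.
  by rewrite cross_direction lt0r_neq0// sin_gt0_pi// arc_span.
have cbox := @compact_frame_box R (cen i) _ _ 0 1 0 1 pq.
have sbox : C `<=` [set x | 0 <= dot (x - cen i) (p i) <= 1 /\ 0 <= dot (x - cen i) (q i) <= 1].
  by move=> x Cx; split; [exact: tangent_p_bounds|exact: tangent_q_bounds].
exact: subclosed_compact tangent_closed cbox sbox.
Qed.

(** Inside [C] it is confined to the triangle between the chord of arc [i] and
    the tangents at its endpoints. *)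
Definition cap i : set (plane R) := [set x | beyond_chord (p i) (q i) (x - cen i)].

(** Separate [x] from [S] by a direction and take the point of [P] extreme in
    it. This point is not a vertex, since a vertex would be extreme for [C]
    too, although [x] is beyond all vertices. So it is inside an arc, and
    [cap_detect] puts [x] in the cap of this arc. *)
Lemma tangent_cover x : C x -> ~ S x -> exists i, cap i x.
Proof.
move=> Cx Sx; have [S0 cS xS] := skeleton_body.
have [e eS] := compact_separation S0 cS xS Sx.
have e0 : e != 0.
  by apply/eqP => e0; have [z /eS] := S0; rewrite e0 /dot /= !mul0r ltxx.
have [P0 cP _] := reuleaux_body hP.
have [y Py ymax] := compact_support_point e P0 cP.
case: (support_cases e0 Py ymax) => [[eC [i yE]]|[i [s [t [s0 t0 eE]]]]].
  by have := eS _ (source_skeleton i); rewrite -yE ltNge eC.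
exists i; rewrite /cap /=.
have /andP[_ xp] := tangent_p_bounds i Cx; have /andP[_ xq] := tangent_q_bounds i Cx.
apply: (cap_detect s0 t0 xp xq); rewrite -eE !(dotC _ e) dotDr dotNr ltrBrDl -dotDr.
  exact: eS (source_skeleton i).
exact: eS (target_skeleton i).
Qed.

Lemma difference_bounds i x y : C x -> C y ->
  dot (x - y) (p i) <= 1 /\ dot (x - y) (q i) <= 1.
Proof.
move=> Cx Cy.
have /andP[_ xp] := tangent_p_bounds i Cx; have /andP[_ xq] := tangent_q_bounds i Cx.
have /andP[yp _] := tangent_p_bounds i Cy; have /andP[yq _] := tangent_q_bounds i Cy.
by move: xp xq yp yq; rewrite !dotDl !dotNl; split; lra.
Qed.

(** As in [tangent_cover], separate [w] from [S - S] by a direction [e] and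
    take the points of [P] extreme in the directions [e] and [- e]. They
    cannot both be vertices; if the first one is inside an arc then [w] is
    beyond its chord, and if the second one is then so is [- w]. *)
Lemma difference_cover w : minkowski_sum C (reflection C) w ->
  ~ minkowski_sum S (reflection S) w ->
  exists i, beyond_chord (p i) (q i) w \/ beyond_chord (p i) (q i) (- w).
Proof.
move=> /minkowski_reflectionP[x [x' [Cx Cx' wE]]] Sw.
have [S0 cS xS] := skeleton_body.
have S20 : minkowski_sum S (reflection S) !=set0.
  have [z Sz] := S0; exists (z - z); apply/minkowski_reflectionP; by exists z, z.
have [e eS] := compact_separation S20
  (compact_minkowski_sum cS (compact_reflection cS))
  (convex_minkowski_sum xS (convex_reflection xS)) Sw.
have {}eS y z : S y -> S z -> dot e (y - z) < dot e w.
  by move=> Sy Sz; apply: eS; apply/minkowski_reflectionP; exists y, z.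
have e0 : e != 0.
  by apply/eqP => e0; have [z Sz] := S0; have := eS z z Sz Sz; rewrite e0 /dot /= !mul0r ltxx.
have [P0 cP _] := reuleaux_body hP.
have [y Py ymax] := compact_support_point e P0 cP.
have [y' Py' ymax'] := compact_support_point (- e) P0 cP.
have e0' : - e != 0 by rewrite oppr_eq0.
have capture i s t f v : 0 <= s -> 0 <= t -> f = s *: p i + t *: q i ->
    dot v (p i) <= 1 -> dot v (q i) <= 1 ->
    (forall y z, S y -> S z -> dot f (y - z) < dot f v) -> beyond_chord (p i) (q i) v.
  move=> s0 t0 fE vp vq fS; apply: (cap_detect s0 t0 vp vq); rewrite -fE !(dotC _ f).
    have -> : p i = arc_source (g i) - cen i by rewrite addrC addKr.
    by apply: fS; [exact: source_skeleton|exact: center_skeleton].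
  have -> : q i = arc_target (g i) - cen i by rewrite addrC addKr.
  by apply: fS; [exact: target_skeleton|exact: center_skeleton].
case: (support_cases e0 Py ymax) => [[eC [i yE]]|[i [s [t [s0 t0 eE]]]]]; last first.
  exists i; left; have [wp wq] := difference_bounds i Cx Cx'.
  by rewrite -wE in wp wq; exact: capture eE wp wq eS.
case: (support_cases e0' Py' ymax') => [[eC' [j yE']]|[j [s [t [s0 t0 eE]]]]]; last first.
  exists j; right; have [wp wq] := difference_bounds j Cx' Cx.
  rewrite -opprB -wE in wp wq; apply: capture eE wp wq _ => // u v Su Sv.
  by rewrite !dotNl dotNr opprK -dotNr opprB; exact: eS.
have := eS _ _ (source_skeleton i) (source_skeleton j); rewrite -yE -yE' wE.
have := eC _ Cx; have := eC' _ Cx'; rewrite !dotDr !dotNr !dotNl; lra.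
Qed.

(** The part of the difference body of [K] beyond a chord is no larger than
    the corresponding cap of [K]. Write [w = x - y]. As [y - cen i] has
    nonnegative inner products with [p i] and [q i], subtracting it from
    [x - cen i] keeps the result in the triangle of [x - cen i], [p i] and
    [q i], by [cap_triangle]. Translated by [cen i], the vertices of this
    triangle are points of [K]. *)
Lemma cap_difference K i w : convex_set K -> S `<=` K -> K `<=` C ->
  minkowski_sum K (reflection K) w -> beyond_chord (p i) (q i) w -> K (cen i + w).
Proof.
move=> xK SK KC /minkowski_reflectionP[x [y [Kx Ky wE]]] cw.
have /andP[_ xp] := tangent_p_bounds i (KC _ Kx).
have /andP[_ xq] := tangent_q_bounds i (KC _ Kx).
have /andP[yp _] := tangent_p_bounds i (KC _ Ky).
have /andP[yq _] := tangent_q_bounds i (KC _ Ky).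
have [||s [t [r [s0 t0 r0 str ->]]]] :=
    cap_triangle (arc_span i) (x := x - cen i) (w := w) _ _ xp xq cw.
- by move: yp; rewrite wE !dotDl !dotNl; lra.
- by move: yq; rewrite wE !dotDl !dotNl; lra.
have -> : cen i + (s *: (x - cen i) + t *: p i + r *: q i) =
    s *: x + t *: arc_source (g i) + r *: arc_target (g i).
  exact: affine_shift.
by apply: convex_comb3 => //; apply: SK; [exact: source_skeleton|exact: target_skeleton].
Qed.

(** * Disjointness of the caps *)

Lemma open_arc_intro i t : a i < t < b i -> open_arc (g i) (cen i + direction t).
Proof. by move=> atb; exists t => //=; rewrite in_itv. Qed.

Lemma open_arc_in i t : a i < t < b i -> P (cen i + direction t).
Proof. by move=> /andP[/ltW at_ /ltW tb]; apply: arc_in; rewrite at_ tb. Qed.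

Lemma open_arc_inj i j x : open_arc (g i) x -> open_arc (g j) x -> i = j.
Proof.
move=> xi xj; apply/eqP; apply: contraT => /(reuleaux_disjoint hP).
by rewrite -subset0 => /(_ x); case; split.
Qed.

Lemma difference_cap_polar i w : minkowski_sum C (reflection C) w ->
  beyond_chord (p i) (q i) w -> exists r t, [/\ 0 < r, a i < t < b i & w = r *: direction t].
Proof.
move=> /minkowski_reflectionP[x [y [Cx Cy ->]]]; have [wp wq] := difference_bounds i Cx Cy.
by move=> cw; have := cap_polar (arc_span i) wp wq cw.
Qed.

(** Let [e] be the direction of [w]. Both [cen i + e] and [cen j + e] are in
    [P]. Their distances to [cen j] and [cen i] are at most 1, and the
    parallelogram law gives [cen i = cen j]. So [cen i + e] is inside both
    arcs. *)
Lemma difference_cap_inj i j w : minkowski_sum C (reflection C) w ->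
  beyond_chord (p i) (q i) w -> beyond_chord (p j) (q j) w -> i = j.
Proof.
move=> Cw /(difference_cap_polar Cw)[r [t [r0 ti wE]]].
move=> /(difference_cap_polar Cw)[r' [t' [r0' tj wE']]].
have tt' : direction t = direction t' :> plane R by apply: (polar_inj r0 r0'); rewrite -wE.
have [d dE] : exists d, d = cen i - cen j by exists (cen i - cen j).
have h1 := reuleaux_diameter (open_arc_in ti) (center_in j).
have h2 := reuleaux_diameter (open_arc_in tj) (center_in i).
have d0 : d = 0.
  apply/dot_eq0/le_anti; rewrite dot_ge0 andbT.
  move: h1 h2; rewrite -tt' addrAC -dE addrAC -(opprB (cen i)) -dE.
  by rewrite !dotE dot_directionv (dotC _ d); lra.
have cE : cen i = cen j by apply/eqP; rewrite -subr_eq0 -dE d0.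
apply: (open_arc_inj (x := cen i + direction t)); first exact: open_arc_intro.
by rewrite cE tt'; exact: open_arc_intro.
Qed.

(** Let [e] be the direction of [w], so that [cen i + e] and [cen j - e] are
    in [P]. The distance between these two points and the distance between
    [cen i] and [cen j] are at most 1. By the parallelogram law
    [cen j = cen i + e], which is a vertex inside arc [i]. *)
Lemma difference_cap_opp i j w : minkowski_sum C (reflection C) w ->
  beyond_chord (p i) (q i) w -> beyond_chord (p j) (q j) (- w) -> False.
Proof.
move=> Cw /(difference_cap_polar Cw)[r [t [r0 ti wE]]].
move=> /(difference_cap_polar (difference_bodyN Cw))[r' [t' [r0' tj wE']]].
have tt' : direction (t + pi) = direction t' :> plane R.
  by apply: (polar_inj r0 r0'); rewrite direction_half_turn scalerN -wE.
have [d dE] : exists d, d = cen i - cen j + direction t by exists (cen i - cen j + direction t).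
have h1 := reuleaux_diameter (open_arc_in ti) (open_arc_in tj).
have h2 := reuleaux_diameter (center_in i) (center_in j).
have d0 : d = 0.
  apply/dot_eq0/le_anti; rewrite dot_ge0 andbT.
  move: h1 h2; rewrite -tt' direction_half_turn opprD opprK addrACA addrA -dE.
  have -> : cen i - cen j = d - direction t by rewrite dE addrK.
  by rewrite !dotE dot_directionv (dotC _ d); lra.
have [k kE] := center_vertex j.
apply: (source_notin_open_arc (i := i) (j := k)); rewrite -kE.
have -> : cen j = cen i + direction t.
  by apply/esym/eqP; rewrite -subr_eq0 addrAC -dE d0.
exact: open_arc_intro.
Qed.

(** A point of [P] beyond the chord of arc [j] but not on the arc is in the
    interior of the triangle formed by the endpoints of the arc and the point
    of the arc in its direction. These three points are in [P], so no nonzero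
    functional is maximal on [P] at the given point. *)
Lemma cap_normal j y e : e != 0 -> P y -> normal e y -> cap j y -> open_arc (g j) y.
Proof.
move=> e0 Py ne cy; have Cy : C y by exact: polygon_sub_tangent.
have /andP[_ yp] := tangent_p_bounds j Cy; have /andP[_ yq] := tangent_q_bounds j Cy.
have [r [t [r0 tj yE]]] := cap_polar (arc_span j) yp yq cy.
have yE' : y = cen j + r *: direction t by rewrite -yE addrC subrK.
have r1 : r <= 1.
  have := reuleaux_diameter Py (center_in j).
  by rewrite yE !dotE dot_directionv; nra.
have [rE|rn1] := eqVneq r 1.
  by rewrite yE' rE scale1r; exact: open_arc_intro.
have {rn1}r1 : r < 1 by rewrite lt_neqAle rn1.
have cy' := cy; rewrite /cap /= yE in cy'.
have [k [l [k0 l0 kl E]]] := cap_comb (arc_span j) r0 tj cy'.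
have le x : P (cen j + x) -> dot e x <= r * dot e (direction t).
  by move=> /ne; rewrite /half_plane /= yE' !dotDr dotZr lerD2l.
have De := le _ (open_arc_in tj).
have Dp := le _ (source_in j).
have Dq : dot e (q j) <= r * dot e (direction t).
  by apply: le; rewrite -/(arc_target (g j)); have := source_in (ordS j);
    rewrite -(reuleaux_consecutive hP).
have := congr1 (dot e) E; rewrite !dotE.
move: De Dp Dq; set D := dot e (direction t); set p' := dot e _; set q' := dot e _ => De Dp Dq DE.
have Dle0 : D <= 0 by nra.
have rD0 : 0 <= r * D by nra.
have rDE : r * D = 0 by nra.
have [p0 q0] : p' = 0 /\ q' = 0 by nra.
move: e0; have -> : e = 0.
  apply: (@dot_frame_inj _ (p j) (q j)).
  - by rewrite cross_direction lt0r_neq0// sin_gt0_pi// arc_span.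
  - by rewrite -/p' p0 /dot /= !mul0r addr0.
  - by rewrite -/q' q0 /dot /= !mul0r addr0.
by rewrite eqxx.
Qed.

Lemma source_notin_cap i j : ~ cap j (arc_source (g i)).
Proof.
move=> cs; apply: (source_notin_open_arc (i := j) (j := i)).
apply: (cap_normal (direction_neq0 _) (source_in i) _ cs).
exact: arc_half_plane.
Qed.

Lemma target_notin_cap i j : ~ cap j (arc_target (g i)).
Proof. by rewrite (reuleaux_consecutive hP); exact: source_notin_cap. Qed.

(** When [r <= 1] the point is in a triangle with vertices on arc [i], two of
    which are its endpoints. Each of these vertices has a nonzero normal, so
    by [cap_normal] it could be in another cap only as an interior point of
    the other arc, which it is not. The complement of a half-plane is convex,
    so the triangle is outside the other cap. *)
Lemma cap_near i j r t : 0 < r -> r <= 1 -> a i < t < b i -> i != j ->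
  cap i (cen i + r *: direction t) -> ~ cap j (cen i + r *: direction t).
Proof.
move=> r0 r1 ti ij; rewrite {1}/cap /= addrC addKr => ci cj.
have out u : ~ cap j (cen i + u) ->
    dot (p j + q j) u < r * dot (p j + q j) (direction t).
  move=> /negP; rewrite -leNgt => h; have := le_lt_trans h cj.
  by rewrite !(dotC _ (p j + q j)) !(dotDr (p j + q j)) ltrD2r ltrD2l dotZr.
apply: (cap_extreme (arc_span i) r0 r1 ti ci (n := p j + q j)); apply: out.
- move=> cy.
  have ne : normal (direction t) (cen i + direction t) by exact: arc_half_plane.
  have yj := cap_normal (direction_neq0 _) (open_arc_in ti) ne cy.
  by move/eqP: ij; apply; exact: open_arc_inj (open_arc_intro ti) yj.
- exact: source_notin_cap.
- exact: target_notin_cap.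
Qed.

(** By [cap_near] only points at distance more than 1 from both centres
    remain. Such a point lies on the outward normals of [P] at points of the
    two open arcs, so both of these points are the projection of [x] to [P]
    and they coincide. *)
Lemma cap_disjoint i j x : C x -> cap i x -> cap j x -> i = j.
Proof.
move=> Cx ci cj; apply/eqP/contraT => ij.
have polar k : cap k x -> exists r t, [/\ 0 < r, a k < t < b k & x = cen k + r *: direction t].
  have /andP[_ xp] := tangent_p_bounds k Cx; have /andP[_ xq] := tangent_q_bounds k Cx.
  move=> /(cap_polar (arc_span k) xp xq)[r [t [r0 tk E]]].
  by exists r, t; split => //; rewrite -E addrC subrK.
have [r [t [r0 ti xE]]] := polar i ci; have [r' [t' [r0' tj xE']]] := polar j cj.
have [r1|r1] := leP r 1.
  by case: (cap_near r0 r1 ti ij); rewrite -xE.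
have [r1'|r1'] := leP r' 1.
  by case: (cap_near r0' r1' tj (i := j) (j := i)); rewrite -?xE' 1?eq_sym.
have normal_open k s : normal (direction s) (cen k + direction s).
  exact: arc_half_plane.
have [d d_def] : exists d, d = cen i + direction t - (cen j + direction t').
  by exists (cen i + direction t - (cen j + direction t')).
(* Nonexpansiveness of the projection: [d] joins the two projections, and both
   normals point from [P] to the same [x]. *)
have e1 : 0 <= dot (direction t) d.
  by have := normal_open i t _ (open_arc_in tj);
    rewrite /half_plane /= -subr_ge0 -dotNr -dotDr -d_def.
have e2 : dot (direction t') d <= 0.
  by have := normal_open j t' _ (open_arc_in ti);
    rewrite /half_plane /= -subr_le0 -dotNr -dotDr -d_def.
have dE : d = (r' - 1) *: direction t' - (r - 1) *: direction t.
  rewrite d_def !scalerBl !scale1r.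
  have -> : r *: direction t = x - cen i by rewrite xE addrC addKr.
  have -> : r' *: direction t' = x - cen j by rewrite xE' addrC addKr.
  move: (direction t) (direction t') (cen i) (cen j) => [u1 u2] [v1 v2] [c1 c2] [d1 d2].
  by case: (x) => x1 x2; congr (_, _) => /=; ring.
have d0 : d = 0.
  apply/dot_eq0/le_anti; rewrite dot_ge0 andbT {1}dE dotDl dotNl !dotZl; nra.
move/eqP: ij; case; apply: open_arc_inj (open_arc_intro ti) _.
have -> : cen i + direction t = cen j + direction t' by apply/eqP; rewrite -subr_eq0 -d_def d0.
exact: open_arc_intro.
Qed.

(** * Areas of a body and of its difference body *)

Lemma cap_borel i : borel_plane (cap i).
Proof.
have -> : cap i =
    [set x | 1 + dot (p i) (q i) + dot (cen i) (p i + q i) < dot x (p i + q i)].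
  apply/seteqP; split => x; rewrite /cap /beyond_chord /= dotDl dotNl; lra.
exact: borel_half_plane_gt.
Qed.

(** Every arc contributes to the difference body a half-plane and its
    opposite, indexed by the two summands. *)
Definition difference_cap (k : 'I_n + 'I_n) : set (plane R) :=
  match k with
  | inl i => beyond_chord (p i) (q i)
  | inr i => [set w | beyond_chord (p i) (q i) (- w)]
  end.

Lemma difference_cap_borel k : borel_plane (difference_cap k).
Proof.
case: k => i; first exact: borel_half_plane_gt.
have -> : difference_cap (inr i) =
    [set x | 1 + dot (p i) (q i) < dot x (- (p i + q i))].
  by apply/seteqP; split => x; rewrite /= /beyond_chord /= dotNl dotNr.
exact: borel_half_plane_gt.
Qed.

Lemma difference_cap_disjoint k l w : minkowski_sum C (reflection C) w ->
  difference_cap k w -> difference_cap l w -> k = l.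
Proof.
move=> Cw; case: k l => [i|i] [j|j] /= ci cj.
- by rewrite (difference_cap_inj Cw ci cj).
- by case: (difference_cap_opp Cw ci cj).
- by case: (difference_cap_opp Cw cj ci).
- by rewrite (difference_cap_inj (difference_bodyN Cw) ci cj).
Qed.

(** The right-hand side does not depend on [K]. Each cap of [K] is counted
    once in the area of [K] and twice, up to translation and reflection, in
    the area of its difference body. The mixed area is half the difference
    between the area of the difference body and twice the area of [K], so the
    caps cancel. *)
Lemma mixed_area_between K : convex_body K -> S `<=` K -> K `<=` C ->
  mixed_area K (reflection K) =
  (area (minkowski_sum S (reflection S) `\` \bigcup_k difference_cap k) -
   area (S `\` \bigcup_i cap i) *+ 2) / 2.
Proof.
move=> [K0 cK xK] SK KC.
pose D := minkowski_sum K (reflection K).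
have SD : minkowski_sum S (reflection S) `<=` D.
  by apply: minkowski_sumS => // _ [x Sx <-]; exists x => //; exact: SK.
have DC : D `<=` minkowski_sum C (reflection C).
  by apply: minkowski_sumS => // _ [x Kx <-]; exists x => //; exact: KC.
have cD : compact D by apply: compact_minkowski_sum => //; exact: compact_reflection.
have bK := compact_borel_plane cK; have bD := compact_borel_plane cD.
have areaK := area_partition bK (compact_finite_area cK) cap_borel
  (fun i j x Kx => cap_disjoint (KC x Kx)).
have areaD := area_partition bD (compact_finite_area cD) difference_cap_borel
  (fun k l w Dw => difference_cap_disjoint (DC w Dw)).
have restK : K `\` \bigcup_i cap i = S `\` \bigcup_i cap i.
  apply/seteqP; split => x [Kx ncap]; split => //; last exact: SK.
  apply: contrapT => Sx; have [i ci] := tangent_cover (KC _ Kx) Sx.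
  by apply: ncap; exists i.
have restD : D `\` \bigcup_k difference_cap k =
    minkowski_sum S (reflection S) `\` \bigcup_k difference_cap k.
  apply/seteqP; split => w [Dw ncap]; split => //; last exact: SD.
  apply: contrapT => Sw; have [i ci] := difference_cover (DC _ Dw) Sw.
  by apply: ncap; case: ci => ci; [exists (inl i)|exists (inr i)].
have bcap i : borel_plane (K `&` cap i).
  by apply: measurableI; [exact: bK|exact: cap_borel].
have capD i : D `&` difference_cap (inl i) = [set w | (K `&` cap i) (cen i + w)].
  apply/seteqP; split => w /=; rewrite /cap /= addrAC subrr add0r.
    by move=> [Dw cw]; split => //; exact: (cap_difference xK SK KC).
  move=> [Kw cw]; split => //; apply/minkowski_reflectionP.
  exists (cen i + w), (cen i); split => //; last by rewrite addrAC subrr add0r.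
  by apply: SK; exact: center_skeleton.
have bcapD i : borel_plane (D `&` difference_cap (inl i)).
  by apply: measurableI; [exact: bD|exact: difference_cap_borel].
have capDN i : D `&` difference_cap (inr i) = reflection (D `&` difference_cap (inl i)).
  apply/seteqP; split => [w [Dw cw]|_ [w [Dw cw] <-]].
    by exists (- w); [split => //; exact: difference_bodyN|exact: opprK].
  by split; [exact: difference_bodyN|rewrite /= opprK].
have {}areaD : area D =
    area (minkowski_sum S (reflection S) `\` \bigcup_k difference_cap k) +
    (\sum_i area (K `&` cap i)) *+ 2.
  rewrite areaD restD big_sumType /=; congr (_ + _); rewrite mulr2n.
  congr (_ + _); apply: eq_bigr => i _.
    by rewrite -/(difference_cap (inl i)) capD area_translation.
  by rewrite -/(difference_cap (inr i)) capDN area_reflection// capD area_translation.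
rewrite /mixed_area -/D areaD area_reflection// areaK restK; congr (_ / _).
by rewrite !mulr2n; ring.
Qed.

End reuleaux.

Theorem theorem2 (R : realType) (P : set (plane R)) (n : nat)
    (g : 'I_n -> unit_arc R) (hP : reuleaux_polygon P g)
    (K : set (plane R)) (hK : convex_body K)
    (hSK : skeleton_polygon g `<=` K) (hKC : K `<=` tangent_polygon P g) :
  [/\ mixed_area K (reflection K) = mixed_area P (reflection P),
      mixed_area P (reflection P) =
        mixed_area (skeleton_polygon g) (reflection (skeleton_polygon g)) &
      mixed_area (skeleton_polygon g) (reflection (skeleton_polygon g)) =
        mixed_area (tangent_polygon P g) (reflection (tangent_polygon P g))].
Proof.
have Pbody := reuleaux_body hP.
have SP := skeleton_sub_polygon hP.
have PC : P `<=` tangent_polygon P g by exact: polygon_sub_tangent.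
have SC : skeleton_polygon g `<=` tangent_polygon P g by apply: subset_trans PC.
have areaE := mixed_area_between hP.
by rewrite (areaE K)// (areaE P)// (areaE _ (skeleton_body hP))//
  (areaE _ (tangent_body hP)).
Qed.
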